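(* Let $\mathbb{F}$ be a field, let $n\ge 1$, and let $A$ and $B$ be $n\times n$ matrices over $\mathbb{F}$. Then $\det(A\cdot B)=\det(A)\cdot\det(B)$.
   Context: Given a vector space $V$ over a field $\mathbb{F}$ and an integer $n\ge 1$, an $n$-determinant on $V$ is a function $D:V^n\to\mathbb{F}$ that is not identically zero, such that for all $v_1,\ldots,v_n,b\in V$ one has $$D(v_1,\ldots,v_n)\cdot b=\sum_{k=1}^n D(v_1,\ldots,v_{k-1},b,v_{k+1},\ldots,v_n)\cdot v_k,$$ and such that $V$ is not spanned by any $n-1$ vectors of $V$ (so that $V$ has dimension $n$ over $\mathbb{F}$). The vector space $\mathbb{F}^n$ has a unique $n$-determinant, denoted $\det$, such that $\det(e_1,\ldots,e_n)=1$, where $e_1,\ldots,e_n$ is the standard basis. For an $n\times n$ matrix $A$ over $\mathbb{F}$ with rows $r_1,\ldots,r_n\in\mathbb{F}^n$, $\det(A)$ means $\det(r_1,\ldots,r_n)$. *)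

(* Defs.v *)
From mathcomp Require Import all_boot all_order all_algebra.
From mathcomp Require Import boolp classical_sets.

Set Implicit Arguments.
Unset Strict Implicit.
Unset Printing Implicit Defensive.
Import GRing.Theory.
Local Open Scope ring_scope.

Definition replace (T : Type) (n : nat) (v : {ffun 'I_n -> T}) (k : 'I_n)
    (b : T) : {ffun 'I_n -> T} :=
  [ffun i => if i == k then b else v i].

Definition spans (F : fieldType) (V : lmodType F) (m : nat)
    (w : {ffun 'I_m -> V}) : Prop :=
  forall x : V, exists c : {ffun 'I_m -> F}, x = \sum_i c i *: w i.

(* Meant for n >= 1: for n = 0 the predecessor n.-1 is 0 too. *)
Record is_ndeterminant (F : fieldType) (V : lmodType F) (n : nat)
    (D : {ffun 'I_n -> V} -> F) : Prop := IsNDeterminant {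
  ndet_neq0 : exists v, D v <> 0;
  ndet_exchange : forall v b, D v *: b = \sum_k D (replace v k b) *: v k;
  ndet_span : forall w : {ffun 'I_n.-1 -> V}, ~ spans w }.

Definition std_basis (F : fieldType) (n : nat) : {ffun 'I_n -> 'rV[F]_n} :=
  [ffun i => delta_mx 0 i].

Definition is_std_ndeterminant (F : fieldType) (n : nat)
    (D : {ffun 'I_n -> 'rV[F]_n} -> F) : Prop :=
  is_ndeterminant D /\ D (std_basis F n) = 1.

(* The default value 0 is never used when n >= 1, see [ndetP] and
   [ndet_unique] below. *)
Definition ndet (F : fieldType) (n : nat) : {ffun 'I_n -> 'rV[F]_n} -> F :=
  xget (fun=> 0) [set D | is_std_ndeterminant D]%classic.

Definition ndetmx (F : fieldType) (n : nat) (A : 'M[F]_n) : F :=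
  ndet [ffun i => row i A].

Definition rows_mx (F : fieldType) (n : nat) (v : {ffun 'I_n -> 'rV[F]_n}) :
    'M[F]_n :=
  \matrix_i v i.

Definition rows_det (F : fieldType) (n : nat) (v : {ffun 'I_n -> 'rV[F]_n}) :
    F :=
  \det (rows_mx v).

Lemma std_basis_mx (F : fieldType) (n : nat) :
  rows_mx (std_basis F n) = 1%:M.
Proof. by apply/row_matrixP => i; rewrite rowK ffunE row1. Qed.

Lemma rows_det_replace (F : fieldType) (n : nat)
    (v : {ffun 'I_n -> 'rV[F]_n}) (k : 'I_n) (b : 'rV[F]_n) :
  rows_det (replace v k b) = (b *m \adj (rows_mx v)) 0 k.
Proof.
rewrite /rows_det (expand_det_row _ k) mxE; apply: eq_bigr => j _.
rewrite !mxE ffunE eqxx; congr (_ * (_ * \det _)).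
by apply/matrixP=> i l; rewrite !mxE ffunE eq_sym (negPf (neq_lift _ _)).
Qed.

Lemma rows_det_std (F : fieldType) (n : nat) (n_gt0 : (0 < n)%N) :
  is_std_ndeterminant (@rows_det F n).
Proof.
have det1 : rows_det (std_basis F n) = 1 by rewrite /rows_det std_basis_mx det1.
split=> //; split.
- by exists (std_basis F n); rewrite det1; apply/eqP/oner_neq0.
- move=> v b; rewrite -mul_mx_scalar -mul_adj_mx mulmxA mulmx_sum_row.
  by apply: eq_bigr => k _; rewrite rows_det_replace rowK.
- move=> w w_span; pose W : 'M[F]_(n.-1, n) := \matrix_i w i.
  have: (1%:M <= W)%MS.
    apply/row_subP => i; have [c ->] := w_span (row i 1%:M).
    by apply: summx_sub => j _; rewrite scalemx_sub // -[w j](rowK w) row_sub.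
  move/mxrankS; rewrite mxrank1 => /leq_trans/(_ (rank_leq_row W)).
  by rewrite -ltnS prednK // ltnn.
Qed.

Lemma ndet_singular (F : fieldType) (n : nat)
    (D : {ffun 'I_n -> 'rV[F]_n} -> F) (v : {ffun 'I_n -> 'rV[F]_n}) :
  is_ndeterminant D -> rows_mx v \notin unitmx -> D v = 0.
Proof.
move=> [_ DE _]; rewrite -row_full_unit -sub1mx => /row_subPn[i] iNv.
apply/eqP; apply: contraNT iNv => Dv0.
rewrite -[row i _](scalerK Dv0) DE scalemx_sub // summx_sub // => k _.
by rewrite scalemx_sub // -[v k](rowK v) row_sub.
Qed.

Lemma ndet_replace (F : fieldType) (n : nat)
    (D : {ffun 'I_n -> 'rV[F]_n} -> F) (v : {ffun 'I_n -> 'rV[F]_n})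
    (k : 'I_n) (c : 'rV[F]_n) :
  is_ndeterminant D -> rows_mx v \in unitmx ->
  D (replace v k (c *m rows_mx v)) = D v * c 0 k.
Proof.
move=> [_ DE _] v_unit.
pose d : 'rV[F]_n := \row_k D (replace v k (c *m rows_mx v)).
have : d *m rows_mx v = (D v *: c) *m rows_mx v.
  rewrite -scalemxAl DE mulmx_sum_row.
  by apply: eq_bigr => i _; rewrite mxE rowK.
move/(can_inj (mulmxK v_unit))/rowP/(_ k).
by rewrite !mxE.
Qed.

Lemma ndet_rows_det (F : fieldType) (n : nat)
    (D : {ffun 'I_n -> 'rV[F]_n} -> F) (v : {ffun 'I_n -> 'rV[F]_n}) :
  (0 < n)%N -> is_ndeterminant D ->
  D v = D (std_basis F n) * rows_det v.
Proof.
move=> n_gt0 ndD; have ndd := (rows_det_std F n_gt0).1.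
have good_back (u : {ffun 'I_n -> 'rV[F]_n}) k (c : 'rV[F]_n) :
    rows_mx u \in unitmx -> c 0 k != 0 ->
    (rows_mx (replace u k (c *m rows_mx u)) \in unitmx ->
     D (replace u k (c *m rows_mx u)) =
       D (std_basis F n) * rows_det (replace u k (c *m rows_mx u))) ->
    D u = D (std_basis F n) * rows_det u.
  move=> uU ck0; rewrite unitmxE unitfE -/(rows_det _).
  rewrite (ndet_replace k c ndD uU) (ndet_replace k c ndd uU).
  rewrite mulrA => /(_ _)/(mulIf ck0); apply.
  by rewrite mulf_neq0 // -unitfE -unitmxE.
have [vU|vNU] := boolP (rows_mx v \in unitmx); last first.
  by rewrite (ndet_singular ndD) ?(ndet_singular ndd) ?mulr0.
have [m] := ubnP #|[set i : 'I_n | v i != delta_mx 0 i]|.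
elim: m v vU => // m IHm v vU le_m.
have [->|v_std] := eqVneq v (std_basis F n).
  by rewrite /rows_det std_basis_mx det1 mulr1.
have [k vk] : exists k : 'I_n, v k != delta_mx 0 k.
  apply/existsP; apply: contraNT v_std; rewrite negb_exists => /forallP vE.
  by apply/eqP/ffunP=> i; rewrite ffunE; apply/eqP; have := vE i; rewrite negbK.
have step (u : {ffun 'I_n -> 'rV[F]_n}) : rows_mx u \in unitmx ->
    u k != delta_mx 0 k ->
    ((delta_mx 0 k : 'rV[F]_n) *m invmx (rows_mx u)) 0 k != 0 ->
    (#|[set i : 'I_n | u i != delta_mx 0%R i]| <= m)%N ->
    D u = D (std_basis F n) * rows_det u.
  move=> uU uk ck0 le_um.
  apply: (good_back u k _ uU ck0).
  rewrite mulmxKV // => rU.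
  apply: IHm rU _; apply: leq_trans le_um.
  apply: proper_card; apply/properP; split.
    apply/fintype.subsetP=> i; rewrite !inE ffunE; case: (i =P k) => // ->.
    by rewrite eqxx.
  by exists k; rewrite !inE // ffunE !eqxx.
pose c : 'rV[F]_n := delta_mx 0 k *m invmx (rows_mx v).
have cE : c *m rows_mx v = delta_mx 0 k by rewrite mulmxKV.
have [ck0|] := eqVneq (c 0 k) 0; last by move=> ck0; apply: step.
clearbody c.
(* e_k has no v_k component: first replace some other v_i by v_i + v_k. *)
have [i /andP[ci0 vi]] : exists i, (c 0 i != 0) && (v i != delta_mx 0 i).
  apply/existsP; apply: contraT; rewrite negb_exists => /forallP c_std.
  have /rowP/(_ k) := cE; rewrite mulmx_sum_row summxE big1 => [|j _].
    by rewrite mxE !eqxx => /esym/eqP; rewrite oner_eq0.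
  rewrite rowK mxE; have [->|cj0] := eqVneq (c 0 j) 0; first by rewrite mul0r.
  have /eqP-> : v j == delta_mx 0 j by have := c_std j; rewrite cj0 /= negbK.
  rewrite mxE eqxx /=; case: eqP => [kj|]; last by rewrite mulr0.
  by rewrite -kj ck0 eqxx in cj0.
have ik : i != k by apply: contraNneq ci0 => ->; rewrite ck0.
pose a : 'rV[F]_n := delta_mx 0 i + delta_mx 0 k.
have aE : a *m rows_mx v = v i + v k by rewrite mulmxDl -!rowE !rowK.
have ai : a 0 i != 0 by rewrite !mxE !eqxx (negPf ik) addr0 oner_neq0.
apply: (good_back v i a vU ai); rewrite aE.
set u := replace v i _ => uU.
have uk : u k = v k by rewrite ffunE eq_sym (negPf ik).
have ui : u i = v i + v k by rewrite ffunE eqxx.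
have uj j : j != i -> u j = v j by move=> ji; rewrite ffunE (negPf ji).
apply: step => //; first by rewrite uk.
  have c'E : (c - c 0 i *: delta_mx 0 k) *m rows_mx u = delta_mx 0 k.
    rewrite -[RHS]cE mulmxBl -scalemxAl -rowE rowK uk !mulmx_sum_row.
    rewrite (bigD1 i) //= [RHS](bigD1 i) //= !rowK ui scalerDr.
    rewrite addrAC addrK; congr (_ + _).
    by apply: eq_bigr => j ji; rewrite !rowK uj.
  by rewrite -c'E mulmxK // !mxE !eqxx ck0 mulr1 sub0r oppr_eq0.
rewrite -ltnS; apply: leq_trans le_m; rewrite ltnS; apply: subset_leq_card.
apply/fintype.subsetP=> j; rewrite !inE; have [->|ji] := eqVneq j i; first by rewrite vi.
by rewrite uj.
Qed.

Lemma ndetP (F : fieldType) (n : nat) : (0 < n)%N ->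
  is_std_ndeterminant (@ndet F n).
Proof.
by move=> n_gt0; apply: xgetPex; exists (@rows_det F n); apply: rows_det_std.
Qed.

Lemma ndet_unique (F : fieldType) (n : nat)
    (D : {ffun 'I_n -> 'rV[F]_n} -> F) :
  (0 < n)%N -> is_std_ndeterminant D -> D = @ndet F n.
Proof.
move=> n_gt0 [ndD D1]; have [ndN N1] := ndetP F n_gt0.
apply/funext => v; rewrite (ndet_rows_det v _ ndD) // (ndet_rows_det v _ ndN) //.
by rewrite D1 N1.
Qed.

(* Main.v *)
(* By uniqueness, the standard n-determinant is the Leibniz determinant of the
   matrix of rows, which is multiplicative. *)
Require Import Defs.
From mathcomp Require Import all_boot all_order all_algebra.
Local Open Scope ring_scope.

(** The exchange identity and the value 1 at the standard basis determine a single function. [\det]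
    of the rows is such a function, the exchange identity being Cramer's rule in adjugate form, so
    [ndetmx] inherits the product rule from [\det]. *)

Lemma ndetmxE (F : fieldType) (n : nat) (n_gt0 : (0 < n)%N) (A : 'M[F]_n) :
  ndetmx A = \det A.
Proof.
(* Positivity of [n] matters: for [n = 0] no n-determinant exists and [ndet] is the default 0, while
   [\det] is 1. *)
rewrite /ndetmx -(ndet_unique n_gt0 (rows_det_std F n_gt0)) /rows_det.
by congr (\det _); apply/row_matrixP => i; rewrite rowK ffunE.
Qed.

Theorem corollary4p4 (F : fieldType) (n : nat) (n_gt0 : (1 <= n)%N)
    (A B : 'M[F]_n) :
  ndetmx (A *m B) = ndetmx A * ndetmx B.
Proof. by rewrite !ndetmxE // det_mulmx. Qed.
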